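(* The set $\Sigma_{1,0,1}^{\mathcal{T}(\mathcal{L}_{\mathsf{BT}})}$ of all $\Sigma_{1,0,1}$-sentences in the language $\mathcal{L}_{\mathsf{BT}}=\{\perp,\langle\cdot,\cdot\rangle,\cdot[\cdot\mapsto\cdot]\}$ that are true in $\mathcal{T}(\mathcal{L}_{\mathsf{BT}})$ is undecidable.
   Context: Let $\mathbf{H}$ be the set of all variable-free terms built from a constant $\perp$ and a binary function symbol $\langle\cdot,\cdot\rangle$ (finite full binary trees). The substitution $t[r\mapsto s]$ is defined by recursion: it equals $s$ if $t=r$; $\perp$ if $t\neq r$ and $t=\perp$; $\langle t_1[r\mapsto s],t_2[r\mapsto s]\rangle$ if $t\ne r$ and $t=\langle t_1,t_2\rangle$ (i.e. each occurrence of $r$ in $t$ is replaced by $s$). $\mathcal{T}(\mathcal{L}_{\mathsf{BT}})=(\mathbf{H},\perp,\langle\cdot,\cdot\rangle,\cdot[\cdot\mapsto\cdot])$ with $\perp,\langle\cdot,\cdot\rangle$ interpreted as themselves. In this language, $x\sqsubseteq t$ abbreviates $t[x\mapsto\langle x,x\rangle]\neq t$ and $x\not\sqsubseteq t$ abbreviates $t[x\mapsto\langle x,x\rangle]=t$ (so $x\sqsubseteq t$ expresses that $x$ is a subterm of $t$). Bounded quantifiers $\exists x\sqsubseteq t\,\phi$, $\forall x\sqsubseteq t\,\phi$ abbreviate $\exists x[x\sqsubseteq t\wedge\phi]$ and $\forall x[x\sqsubseteq t\rightarrow\phi]$. $\Sigma$-formulas are defined inductively: atomic formulas and their negations are $\Sigma$-formulas;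 if $\phi,\psi$ are $\Sigma$-formulas then so are $\phi\vee\psi$, $\phi\wedge\psi$, $\exists x\sqsubseteq t\,\phi$, $\forall x\sqsubseteq t\,\phi$, $\exists x\,\phi$, where $x$ does not occur in $t$. A $\Sigma_{n,m,k}$-formula is a $\Sigma$-formula containing $n$ unbounded existential quantifiers, $m$ bounded existential quantifiers and $k$ bounded universal quantifiers; $\Sigma^{\mathfrak A}_{n,m,k}$ denotes the set of $\Sigma_{n,m,k}$-sentences true in $\mathfrak A$. *)

(* Defs.v *)
From Stdlib Require Import Arith List.
From Stdlib Require Cantor.
Import ListNotations.

(** * The term model *)

Inductive H : Set :=
| hbot : H
| hpair : H -> H -> H.

Definition H_eq_dec (t r : H) : {t = r} + {t <> r}.
Proof. decide equality. Defined.

(* [hsubst t r s] is t[r |-> s]; the test t = r comes before the recursion, so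
   occurrences of r inside the inserted copies of s are left alone. *)
Fixpoint hsubst (t r s : H) : H :=
  if H_eq_dec t r then s
  else match t with
       | hbot => hbot
       | hpair t1 t2 => hpair (hsubst t1 r s) (hsubst t2 r s)
       end.

(** * First-order logic over the language {bot, <.,.>, .[. |-> .]} *)

Inductive term : Set :=
| tvar : nat -> term
| tbot : term
| tpair : term -> term -> term
| tsubst : term -> term -> term -> term.

Inductive form : Set :=
| fEq : term -> term -> form
| fNot : form -> form
| fAnd : form -> form -> form
| fOr : form -> form -> form
| fImp : form -> form -> form
| fEx : nat -> form -> form
| fAll : nat -> form -> form.

Fixpoint occurs (x : nat) (t : term) : Prop :=
  match t with
  | tvar y => x = y
  | tbot => False
  | tpair a b => occurs x a \/ occurs x b
  | tsubst a b c => occurs x a \/ occurs x b \/ occurs x c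
  end.

Fixpoint free (x : nat) (p : form) : Prop :=
  match p with
  | fEq s t => occurs x s \/ occurs x t
  | fNot p => free x p
  | fAnd p q | fOr p q | fImp p q => free x p \/ free x q
  | fEx y p | fAll y p => x <> y /\ free x p
  end.

Definition sentence (p : form) : Prop := forall x, ~ free x p.

Record structure : Type := Structure {
  carrier : Type;
  i_bot : carrier;
  i_pair : carrier -> carrier -> carrier;
  i_subst : carrier -> carrier -> carrier -> carrier
}.

Definition upd {A : Type} (e : nat -> A) (x : nat) (a : A) : nat -> A :=
  fun y => if Nat.eq_dec y x then a else e y.

Fixpoint teval (A : structure) (e : nat -> carrier A) (t : term) : carrier A :=
  match t with
  | tvar x => e x
  | tbot => i_bot A
  | tpair a b => i_pair A (teval A e a) (teval A e b)
  | tsubst a b c => i_subst A (teval A e a) (teval A e b) (teval A e c)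
  end.

Fixpoint sat (A : structure) (e : nat -> carrier A) (p : form) : Prop :=
  match p with
  | fEq s t => teval A e s = teval A e t
  | fNot p => ~ sat A e p
  | fAnd p q => sat A e p /\ sat A e q
  | fOr p q => sat A e p \/ sat A e q
  | fImp p q => sat A e p -> sat A e q
  | fEx x p => exists a, sat A (upd e x a) p
  | fAll x p => forall a, sat A (upd e x a) p
  end.

Definition true_in (A : structure) (p : form) : Prop := forall e, sat A e p.

Definition T_BT : structure := Structure H hbot hpair hsubst.

(** * Sigma-formulas *)

(* x is a subterm of t:  t[x |-> <x,x>] <> t *)
Definition fSub (x : nat) (t : term) : form :=
  fNot (fEq (tsubst t (tvar x) (tpair (tvar x) (tvar x))) t).

Definition fExB (x : nat) (t : term) (p : form) : form :=
  fEx x (fAnd (fSub x t) p).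

Definition fAllB (x : nat) (t : term) (p : form) : form :=
  fAll x (fImp (fSub x t) p).

(* [Sigma n m k p]: p is a Sigma-formula with n unbounded existential,
   m bounded existential and k bounded universal quantifiers.  Bounded
   quantifiers are abbreviations, so a formula [fExB x t p] may be read either
   as a bounded or as an unbounded existential. *)
Inductive Sigma : nat -> nat -> nat -> form -> Prop :=
| Sigma_eq s t : Sigma 0 0 0 (fEq s t)
| Sigma_neq s t : Sigma 0 0 0 (fNot (fEq s t))
| Sigma_or n m k n' m' k' p q :
    Sigma n m k p -> Sigma n' m' k' q ->
    Sigma (n + n') (m + m') (k + k') (fOr p q)
| Sigma_and n m k n' m' k' p q :
    Sigma n m k p -> Sigma n' m' k' q ->
    Sigma (n + n') (m + m') (k + k') (fAnd p q)
| Sigma_exB n m k x t p :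
    ~ occurs x t -> Sigma n m k p -> Sigma n (S m) k (fExB x t p)
| Sigma_allB n m k x t p :
    ~ occurs x t -> Sigma n m k p -> Sigma n m (S k) (fAllB x t p)
| Sigma_ex n m k x p :
    Sigma n m k p -> Sigma (S n) m k (fEx x p).

Definition Sigma_true (A : structure) (n m k : nat) (p : form) : Prop :=
  Sigma n m k p /\ sentence p /\ true_in A p.

(** * Partial recursive functions *)

(* Arities are not tracked in the syntax: an algorithm applied to an argument
   list of the wrong shape is simply undefined. *)
Inductive recalg : Set :=
| rZero : recalg
| rSucc : recalg
| rProj : nat -> recalg
| rComp : recalg -> list recalg -> recalg
| rPrim : recalg -> recalg -> recalg
| rMin : recalg -> recalg.

(* [computes f v y]: f is defined at v, with value y. *)
Inductive computes : recalg -> list nat -> nat -> Prop :=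
| c_zero v : computes rZero v 0
| c_succ x : computes rSucc [x] (S x)
| c_proj i v y : nth_error v i = Some y -> computes (rProj i) v y
| c_comp f gs v ws y :
    Forall2 (fun g w => computes g v w) gs ws -> computes f ws y ->
    computes (rComp f gs) v y
| c_prim0 f g v y :
    computes f v y -> computes (rPrim f g) (0 :: v) y
| c_primS f g n v r y :
    computes (rPrim f g) (n :: v) r -> computes g (n :: r :: v) y ->
    computes (rPrim f g) (S n :: v) y
| c_min f n v :
    computes f (n :: v) 0 ->
    (forall i, i < n -> exists r, computes f (i :: v) (S r)) ->
    computes (rMin f) v n.

Definition recursive_set (X : nat -> Prop) : Prop :=
  exists f : recalg,
    forall n, (X n /\ computes f [n] 1) \/ (~ X n /\ computes f [n] 0).

(** * Goedel numbering *)

Definition npair (a b : nat) : nat := Cantor.to_nat (a, b).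

Fixpoint tcode (t : term) : nat :=
  match t with
  | tvar x => npair 0 x
  | tbot => npair 1 0
  | tpair a b => npair 2 (npair (tcode a) (tcode b))
  | tsubst a b c => npair 3 (npair (tcode a) (npair (tcode b) (tcode c)))
  end.

Fixpoint fcode (p : form) : nat :=
  match p with
  | fEq s t => npair 0 (npair (tcode s) (tcode t))
  | fNot p => npair 1 (fcode p)
  | fAnd p q => npair 2 (npair (fcode p) (fcode q))
  | fOr p q => npair 3 (npair (fcode p) (fcode q))
  | fImp p q => npair 4 (npair (fcode p) (fcode q))
  | fEx x p => npair 5 (npair x (fcode p))
  | fAll x p => npair 6 (npair x (fcode p))
  end.

Lemma npair_inj a b c d : npair a b = npair c d -> a = c /\ b = d.
Proof.
  unfold npair; intros E; apply (f_equal Cantor.of_nat) in E.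
  rewrite !Cantor.cancel_of_to in E; injection E; auto.
Qed.

Lemma tcode_inj s t : tcode s = tcode t -> s = t.
Proof.
  revert t; induction s; intros []; cbn [tcode]; intros E;
    repeat match goal with
    | E : npair _ _ = npair _ _ |- _ => apply npair_inj in E as [? ?]
    end; try discriminate; f_equal; auto.
Qed.

Lemma fcode_inj p q : fcode p = fcode q -> p = q.
Proof.
  revert q; induction p; intros []; cbn [fcode]; intros E;
    repeat match goal with
    | E : npair _ _ = npair _ _ |- _ => apply npair_inj in E as [? ?]
    end; try discriminate; f_equal; auto using tcode_inj.
Qed.

Definition decidable (P : form -> Prop) : Prop :=
  recursive_set (fun n => exists p, n = fcode p /\ P p).

Definition undecidable (P : form -> Prop) : Prop := ~ decidable P.

(* Main.v *)
(** The proof is by diagonalization. For a computable total g and an input m, the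
    sentence [halting m phi] says that some tree z contains <D,m> and that every
    x in z obeys a finite list of rules, compiled from g into [phi], of the form
    "if <P,x> is in z, then <P',x'> is in z". Here P is a program point and x
    the tree of all registers, so z has to contain the whole run of g on m; the
    rule for the final point asks for output 0. One universal variable is enough
    since incrementing or decrementing a register, whose end is marked by a
    constant of its own, is a substitution in x, and a register is 0 exactly if
    decrementing it leaves x unchanged. Since g is total, this sentence is true
    iff g m = 0. If f decided truth, take g c := f (code of the sentence with
    input c and matrix coded by c); the matrix of this g applied to its own code
    is true iff f says that it is not. *)

From Stdlib Require Import Arith List Lia.
Import ListNotations.
Require Import Defs.

(** * Register programs *)

(** Each instruction carries its continuation, so a program point is itself a program. [Loop i b p]
    is a while loop: it repeats [b] as long as register [i] is nonzero, then goes on with [p]. *)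
Inductive prog : Set :=
| Halt : prog
| Inc : nat -> prog -> prog
| Dec : nat -> prog -> prog
| Loop : nat -> prog -> prog -> prog.

Fixpoint papp (p q : prog) : prog :=
  match p with
  | Halt => q
  | Inc i p => Inc i (papp p q)
  | Dec i p => Dec i (papp p q)
  | Loop i b p => Loop i b (papp p q)
  end.

Lemma papp_assoc p q r : papp (papp p q) r = papp p (papp q r).
Proof. induction p; simpl; congruence. Qed.

Lemma papp_Halt p : papp p Halt = p.
Proof. induction p; simpl; congruence. Qed.

Arguments papp : simpl never.

Definition config : Type := prog * (nat -> nat).

Definition next (c : config) : config :=
  let (k, e) := c in
  match k with
  | Halt => (Halt, e)
  | Inc i p => (p, upd e i (S (e i)))
  | Dec i p => (p, upd e i (pred (e i)))
  | Loop i b p => (match e i with 0 => p | S _ => papp b k end, e)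
  end.

Inductive reach : config -> config -> Prop :=
| reach_refl c : reach c c
| reach_next c c' : reach (next c) c' -> reach c c'.

Lemma reach_trans c1 c2 c3 : reach c1 c2 -> reach c2 c3 -> reach c1 c3.
Proof. induction 1; auto using reach_next. Qed.

(** Quantifying over the continuation [k] makes runs compose under [papp]. *)
Definition run (p : prog) (e e' : nat -> nat) : Prop :=
  forall k, reach (papp p k, e) (k, e').

Lemma run_Halt e : run Halt e e.
Proof. intro; apply reach_refl. Qed.

Lemma run_papp p q e1 e2 e3 : run p e1 e2 -> run q e2 e3 -> run (papp p q) e1 e3.
Proof.
  intros H1 H2 k; rewrite papp_assoc; eapply reach_trans; [apply H1 | apply H2].
Qed.

Lemma run_Inc i p e e' : run p (upd e i (S (e i))) e' -> run (Inc i p) e e'.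
Proof. intros H k; apply reach_next, H. Qed.

Lemma run_Dec i p e e' : run p (upd e i (pred (e i))) e' -> run (Dec i p) e e'.
Proof. intros H k; apply reach_next, H. Qed.

Lemma run_Loop_0 i b p e e' : e i = 0 -> run p e e' -> run (Loop i b p) e e'.
Proof. intros E H k; apply reach_next; simpl; rewrite E; apply H. Qed.

Lemma run_Loop_S i b e e1 e' :
  e i <> 0 -> run b e e1 -> run (Loop i b Halt) e1 e' -> run (Loop i b Halt) e e'.
Proof.
  intros E H1 H2 k; apply reach_next; simpl.
  destruct (e i); [easy|].
  eapply reach_trans; [apply H1 | apply H2].
Qed.

(** Invariant rule for a loop whose body lowers its own test register by exactly one; the invariant
    is indexed by the iterations still to come. *)
Lemma run_countdown i b (I : nat -> (nat -> nat) -> Prop) :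
  (forall n e, e i = S n -> I (S n) e ->
     exists e', run b e e' /\ e' i = n /\ I n e') ->
  forall n e, e i = n -> I n e ->
  exists e', run (Loop i b Halt) e e' /\ e' i = 0 /\ I 0 e'.
Proof.
  intros Hb n; induction n as [|n IH]; intros e E HI.
  - exists e; auto using run_Loop_0, run_Halt.
  - destruct (Hb n e E HI) as (e1 & R1 & E1 & I1).
    destruct (IH e1 E1 I1) as (e2 & R2 & E2 & I2).
    exists e2; split; auto.
    apply run_Loop_S with e1; auto; lia.
Qed.

Lemma upd_eq {A} (e : nat -> A) i a : upd e i a i = a.
Proof. unfold upd; destruct (Nat.eq_dec i i); easy. Qed.

Lemma upd_neq {A} (e : nat -> A) i j a : j <> i -> upd e i a j = e j.
Proof. unfold upd; destruct (Nat.eq_dec j i); easy. Qed.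

Ltac updsimp :=
  repeat first [rewrite upd_eq in * | rewrite upd_neq in * by lia].

Definition clear (i : nat) : prog := Loop i (Dec i Halt) Halt.

Lemma run_clear i e :
  exists e', run (clear i) e e' /\ e' i = 0 /\ forall r, r <> i -> e' r = e r.
Proof.
  apply (run_countdown i (Dec i Halt) (fun _ e' => forall r, r <> i -> e' r = e r))
    with (n := e i); auto.
  intros n e1 E I; eexists; split; [apply run_Dec, run_Halt|].
  rewrite E; split; [apply upd_eq|].
  intros; rewrite upd_neq; auto.
Qed.

(** Register [i] is emptied into both [j] and [t], then restored from [t]. *)
Definition copy (i j t : nat) : prog :=
  papp (clear j) (papp (clear t)
    (papp (Loop i (Dec i (Inc j (Inc t Halt))) Halt)
          (Loop t (Dec t (Inc i Halt)) Halt))).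

Lemma run_copy i j t e : i <> j -> i <> t -> j <> t ->
  exists e', run (copy i j t) e e' /\ e' j = e i /\
    forall r, r <> j -> r <> t -> e' r = e r.
Proof.
  intros ij it jt.
  destruct (run_clear j e) as (e1 & R1 & Z1 & F1).
  destruct (run_clear t e1) as (e2 & R2 & Z2 & F2).
  destruct (run_countdown i (Dec i (Inc j (Inc t Halt)))
    (fun n e' => e' j + n = e i /\ e' t + n = e i /\
       forall r, r <> i -> r <> j -> r <> t -> e' r = e r))
    with (n := e i) (e := e2) as (e3 & R3 & Z3 & J3 & T3 & F3).
  - intros n e' E (J & T & F); eexists; split;
      [apply run_Dec, run_Inc, run_Inc, run_Halt|].
    updsimp; rewrite E; repeat split; try lia.
    intros; updsimp; auto.
  - rewrite F2, F1 by auto; auto.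
  - rewrite F2, Z1, Z2 by auto; repeat split; auto.
    intros; rewrite F2, F1; auto.
  - destruct (run_countdown t (Dec t (Inc i Halt))
      (fun n e' => e' i + n = e i /\ forall r, r <> i -> r <> t -> e' r = e3 r))
      with (n := e3 t) (e := e3) as (e4 & R4 & Z4 & I4 & F4).
    + intros n e' E (I & F); eexists; split; [apply run_Dec, run_Inc, run_Halt|].
      updsimp; rewrite E; repeat split; try lia.
      intros; updsimp; auto.
    + reflexivity.
    + split; [lia | auto].
    + exists e4; repeat split.
      * repeat (eapply run_papp; [eassumption|]); assumption.
      * rewrite F4 by auto; lia.
      * intros r rj rt; destruct (Nat.eq_dec r i) as [->|ri]; [lia|].
        rewrite F4, F3; auto.
Qed.

(** * Compiling recursive functions *)

(* The arguments are in the registers [ins], the result goes to register [out]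
   (possibly one of [ins]), and the registers from [n] on are scratch space with
   arbitrary initial contents. *)
Fixpoint compile (f : recalg) (ins : list nat) (out n : nat) : prog :=
  match f with
  | rZero => clear out
  | rSucc => papp (copy (hd 0 ins) n (S n)) (Inc n (copy n out (S n)))
  | rProj i => papp (copy (nth i ins 0) n (S n)) (copy n out (S n))
  | rComp f gs =>
      let m := n + length gs in
      papp ((fix args gs j :=
               match gs with
               | [] => Halt
               | g :: gs => papp (compile g ins j m) (args gs (S j))
               end) gs n)
           (compile f (seq n (length gs)) out m)
  | rPrim f g =>
      papp (copy (hd 0 ins) n (S n)) (papp (clear (1 + n))
        (papp (compile f (tl ins) (2 + n) (3 + n))
          (papp (Loop n (Dec n (papp (compile g (1 + n :: 2 + n :: tl ins) (2 + n) (3 + n))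
                                     (Inc (1 + n) Halt))) Halt)
                (copy (2 + n) out (3 + n)))))
  | rMin f =>
      papp (clear n) (papp (compile f (n :: ins) (1 + n) (2 + n))
        (papp (Loop (1 + n) (Inc n (compile f (n :: ins) (1 + n) (2 + n))) Halt)
              (copy n out (2 + n))))
  end.

(** The generated principle has no induction hypothesis for the list inside [rComp]. *)
Lemma recalg_nested_ind (P : recalg -> Prop) :
  P rZero -> P rSucc -> (forall i, P (rProj i)) ->
  (forall f gs, P f -> Forall P gs -> P (rComp f gs)) ->
  (forall f g, P f -> P g -> P (rPrim f g)) ->
  (forall f, P f -> P (rMin f)) ->
  forall f, P f.
Proof.
  intros HZ HS HP HC HR HM; fix IH 1; intros [| |i|f gs|f g|f];
    [assumption | assumption | apply HP | apply HC | apply HR | apply HM]; try apply IH.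
  induction gs; constructor; auto.
Qed.

(** Nothing is claimed where [f] is undefined. The frame condition keeps inputs and earlier results
    intact across nested calls. *)
Definition correct (f : recalg) : Prop :=
  forall v y, computes f v y ->
  forall ins out n e, Forall (fun i => i < n) ins -> out < n -> map e ins = v ->
  exists e', run (compile f ins out n) e e' /\ e' out = y /\
    forall r, r < n -> r <> out -> e' r = e r.

Lemma map_agree n (e e' : nat -> nat) ins :
  Forall (fun i => i < n) ins -> (forall r, r < n -> e' r = e r) ->
  map e' ins = map e ins.
Proof. intros Hi He; induction Hi; simpl; f_equal; auto. Qed.

Lemma Forall_lt_weaken n m ins :
  n <= m -> Forall (fun i => i < n) ins -> Forall (fun i => i < m) ins.
Proof. intros L; apply Forall_impl; intros; lia. Qed.

(** The detour through scratch register [n] covers the case [out = i], in which a direct copy would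
    clear its own source. *)
Lemma run_copy_twice i n out e : i < n -> out < n ->
  exists e', run (papp (copy i n (S n)) (copy n out (S n))) e e' /\ e' out = e i /\
    forall r, r < n -> r <> out -> e' r = e r.
Proof.
  intros Hi Ho.
  destruct (run_copy i n (S n) e) as (e1 & R1 & C1 & F1); try lia.
  destruct (run_copy n out (S n) e1) as (e2 & R2 & C2 & F2); try lia.
  exists e2; split; [eapply run_papp; eassumption|]; split; [congruence|].
  intros; rewrite F2, F1; lia.
Qed.

Lemma correct_rSucc : correct rSucc.
Proof.
  intros v y C ins out n e Hi Ho <-.
  destruct ins as [|i [|]]; inversion C; subst y; simpl.
  inversion Hi.
  destruct (run_copy i n (S n) e) as (e1 & R1 & C1 & F1); try lia.
  destruct (run_copy n out (S n) (upd e1 n (S (e1 n)))) as (e2 & R2 & C2 & F2); try lia.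
  exists e2; split; [|split].
  - eapply run_papp; [eassumption | apply run_Inc; assumption].
  - rewrite C2; updsimp; lia.
  - intros; rewrite F2, upd_neq, F1; lia.
Qed.

Lemma correct_rProj i : correct (rProj i).
Proof.
  intros v y C ins out n e Hi Ho E; inversion C; subst.
  rewrite nth_error_map in *.
  destruct (nth_error ins i) as [j|] eqn:Ej; [|discriminate].
  simpl; rewrite (nth_error_nth _ _ _ Ej).
  assert (j < n) by (eapply Forall_forall in Hi; [exact Hi | eapply nth_error_In; eassumption]).
  destruct (run_copy_twice j n out e) as (e' & R & O & F); auto.
  exists e'; repeat split; auto; simpl in *; congruence.
Qed.

Lemma correct_rComp f gs : correct f -> Forall correct gs -> correct (rComp f gs).
Proof.
  intros Hf Hgs v y C ins out n e Hi Ho E; inversion C as [| | |? ? ? ws ? Fw Cf| | |]; subst.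
  simpl; set (m := n + length gs).
  match goal with |- context [papp (?F gs n) _] => set (args := F) end.
  (* Generalized to a suffix of [gs] whose results go to the registers from [j] on; registers below
     [j], with the inputs and the results so far, survive. *)
  assert (A : forall hs us, Forall correct hs ->
    Forall2 (fun g w => computes g (map e ins) w) hs us ->
    forall j e0, n <= j -> j + length hs = m -> (forall r, r < n -> e0 r = e r) ->
    exists e', run (args hs j) e0 e' /\ map e' (seq j (length hs)) = us /\
      forall r, r < j -> e' r = e0 r).
  { intros hs us Hc F2; induction F2 as [|g w hs us Cg F2 IH]; intros j e0 Lj Lm F0.
    - exists e0; split; [apply run_Halt | auto].
    - inversion Hc; subst; simpl in Lm.
      destruct (H1 _ _ Cg ins j m e0) as (e1 & R1 & O1 & F1).
      + apply Forall_lt_weaken with n; auto; lia.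
      + lia.
      + apply map_agree with n; auto.
      + destruct (IH H2 (S j) e1) as (e2 & R2 & M2 & F2'); try lia.
        { intros; rewrite F1; auto; lia. }
        exists e2; split; [|split].
        * simpl; eapply run_papp; eassumption.
        * simpl; f_equal; auto; rewrite F2' by lia; auto.
        * intros; rewrite F2', F1; lia. }
  destruct (A gs ws Hgs Fw n e) as (e1 & R1 & M1 & F1); auto.
  destruct (Hf _ _ Cf (seq n (length gs)) out m e1) as (e2 & R2 & O2 & F2); auto.
  { apply Forall_forall; intros r Hr; apply in_seq in Hr; unfold m; lia. }
  { unfold m; lia. }
  exists e2; split; [eapply run_papp; eassumption | split; auto].
  intros; rewrite F2, F1; unfold m; lia.
Qed.

(** The derivation recurses downwards while the compiled loop counts upwards; the table [s] of
    intermediate values mediates between them. *)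
Lemma computes_rPrim_values f g v a y : computes (rPrim f g) (a :: v) y ->
  exists s : nat -> nat, computes f v (s 0) /\
    (forall k, k < a -> computes g (k :: s k :: v) (s (S k))) /\ s a = y.
Proof.
  revert y; induction a as [|a IH]; intros y C; inversion C; subst.
  - exists (fun _ => y); repeat split; auto; lia.
  - destruct (IH r) as (s & S0 & SS & Sa); auto.
    exists (upd s (S a) y); repeat split; updsimp; auto.
    intros k Lk; destruct (Nat.eq_dec k a) as [->|]; updsimp; auto.
    + rewrite Sa; assumption.
    + apply SS; lia.
Qed.

Lemma correct_rPrim f g : correct f -> correct g -> correct (rPrim f g).
Proof.
  intros Hf Hg v y C ins out n e Hi Ho E.
  assert (exists i ins', ins = i :: ins') as (i & is & ->).
  { destruct ins as [|i is]; [subst v; inversion C | eauto]. }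
  simpl in E; subst v.
  inversion Hi as [|? ? Hi0 His]; subst.
  destruct (computes_rPrim_values _ _ _ _ _ C) as (s & S0 & SS & Sy).
  destruct (run_copy i n (S n) e) as (e1 & R1 & C1 & F1); try lia.
  destruct (run_clear (1 + n) e1) as (e2 & R2 & Z2 & F2).
  assert (M : forall e', (forall r, r < n -> e' r = e r) -> map e' is = map e is)
    by (intros; apply map_agree with n; auto).
  assert (L : Forall (fun i => i < 3 + n) is)
    by (apply Forall_lt_weaken with n; auto; lia).
  destruct (Hf _ _ S0 is (2 + n) (3 + n) e2) as (e3 & R3 & O3 & F3); auto.
  { apply M; intros; rewrite F2, F1; lia. }
  (* Register [n] holds the [d] remaining iterations, [1 + n] the number already done, and [2 + n]
     the value of the recursion at that stage. *)
  destruct (run_countdown n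
    (Dec n (papp (compile g (1 + n :: 2 + n :: is) (2 + n) (3 + n)) (Inc (1 + n) Halt)))
    (fun d e' => e' (1 + n) + d = e i /\ e' (2 + n) = s (e' (1 + n)) /\
       forall r, r < n -> e' r = e r)) with (n := e3 n) (e := e3)
    as (e4 & R4 & Z4 & K4 & A4 & F4).
  - intros d e' En (K & A & F).
    destruct (Hg (e' (1 + n) :: s (e' (1 + n)) :: map e is) (s (S (e' (1 + n)))))
      with (ins := 1 + n :: 2 + n :: is) (out := 2 + n) (n := 3 + n)
           (e := upd e' n (pred (e' n))) as (e5 & R5 & O5 & F5).
    + apply SS; lia.
    + repeat constructor; auto; lia.
    + lia.
    + cbn [map]; updsimp; rewrite A; do 2 f_equal.
      apply M; intros; updsimp; auto.
    + eexists; split; [apply run_Dec; eapply run_papp;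
        [eassumption | apply run_Inc, run_Halt]|].
      updsimp; rewrite O5, !F5 by lia; updsimp; rewrite En.
      repeat split; auto; try lia.
      intros; updsimp; rewrite F5 by lia; updsimp; auto.
  - reflexivity.
  - rewrite O3, !F3, Z2, F2 by lia; repeat split; auto.
    intros; rewrite F3, F2, F1; lia.
  - destruct (run_copy (2 + n) out (3 + n) e4) as (e5 & R5 & O5 & F5); try lia.
    exists e5; split; [|split].
    + repeat (eapply run_papp; [eassumption|]); assumption.
    + rewrite O5, A4, <- Sy; f_equal; lia.
    + intros; rewrite F5, F4; lia.
Qed.

Lemma correct_rMin f : correct f -> correct (rMin f).
Proof.
  intros Hf v y C ins out n e Hi Ho E; inversion C as [| | | | | |? ? ? C0 CS]; subst; clear C.
  (* One evaluation of [f] at the candidate [j]: the test register [1 + n] becomes 0 exactly when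
     [j] is the minimum [y]. *)
  assert (A : forall j e0, j <= y -> e0 n = j -> (forall r, r < n -> e0 r = e r) ->
    exists e', run (compile f (n :: ins) (1 + n) (2 + n)) e0 e' /\
      e' n = j /\ (j < y -> e' (1 + n) <> 0) /\ (j = y -> e' (1 + n) = 0) /\
      forall r, r < n -> e' r = e r).
  { intros j e0 Lj Ej F0.
    assert (Cj : exists s, computes f (j :: map e ins) s /\ (j < y -> s <> 0) /\ (j = y -> s = 0)).
    { destruct (Nat.eq_dec j y) as [->|]; [exists 0; repeat split; auto; lia|].
      destruct (CS j) as [s Cs]; [lia | exists (S s); repeat split; auto; lia]. }
    destruct Cj as (s & Cs & S1 & S0).
    destruct (Hf _ _ Cs (n :: ins) (1 + n) (2 + n) e0) as (e1 & R1 & O1 & F1).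
    - constructor; [lia|]; apply Forall_lt_weaken with n; auto; lia.
    - lia.
    - simpl; f_equal; [assumption|]; apply map_agree with n; auto.
    - exists e1; rewrite O1; repeat split; auto.
      + rewrite F1; lia.
      + intros; rewrite F1; auto; lia. }
  (* The test register is recomputed rather than decremented, so [run_countdown] does not apply; the
     induction is on the distance [d] to the minimum. *)
  assert (L : forall d e0, d <= y -> e0 n = y - d ->
    (y - d < y -> e0 (1 + n) <> 0) -> (y - d = y -> e0 (1 + n) = 0) ->
    (forall r, r < n -> e0 r = e r) ->
    exists e', run (Loop (1 + n) (Inc n (compile f (n :: ins) (1 + n) (2 + n))) Halt) e0 e' /\
      e' n = y /\ forall r, r < n -> e' r = e r).
  { induction d as [|d IH]; intros e0 Ld En S1 S0 F0.
    - exists e0; split; [apply run_Loop_0, run_Halt; apply S0; lia|]; split; auto; lia.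
    - destruct (A (y - d) (upd e0 n (S (e0 n)))) as (e1 & R1 & N1 & P1 & Z1 & F1).
      + lia.
      + updsimp; lia.
      + intros; updsimp; auto.
      + destruct (IH e1) as (e2 & R2 & N2 & F2); auto; [lia|].
        exists e2; split; auto.
        apply run_Loop_S with e1; auto; [apply S1; lia | apply run_Inc, R1]. }
  destruct (run_clear n e) as (e1 & R1 & Z1 & F1).
  destruct (A 0 e1) as (e2 & R2 & N2 & P2 & Z2 & F2); auto; [lia | intros; apply F1; lia|].
  destruct (L y e2) as (e3 & R3 & N3 & F3); auto; try (rewrite ?Nat.sub_diag; auto; fail).
  destruct (run_copy n out (2 + n) e3) as (e4 & R4 & O4 & F4); try lia.
  exists e4; split; [|split].
  - repeat (eapply run_papp; [eassumption|]); assumption.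
  - congruence.
  - intros; rewrite F4, F3; lia.
Qed.

Lemma compile_correct f : correct f.
Proof.
  induction f using recalg_nested_ind;
    auto using correct_rSucc, correct_rProj, correct_rComp, correct_rPrim, correct_rMin.
  intros v y C ins out n e _ _ _; inversion C; subst; simpl.
  destruct (run_clear out e) as (e' & R & Z & F); eauto.
Qed.

(** * Trees *)

Fixpoint subtree (r t : H) : Prop :=
  r = t \/ match t with hbot => False | hpair a b => subtree r a \/ subtree r b end.

Lemma subtree_refl t : subtree t t.
Proof. destruct t; left; reflexivity. Qed.

Lemma subtree_trans r s t : subtree r s -> subtree s t -> subtree r t.
Proof.
  intros Hr; induction t; intros [->|Hs]; auto; simpl; intuition.
Qed.

Arguments H_eq_dec : simpl never.

Lemma subtree_right a b t : subtree (hpair a b) t -> subtree b t.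
Proof. apply subtree_trans; right; right; apply subtree_refl. Qed.

Lemma hsubst_same r s : hsubst r r s = s.
Proof. destruct r; simpl; [|destruct H_eq_dec]; easy. Qed.

Lemma hsubst_pair a b r s :
  hpair a b <> r -> hsubst (hpair a b) r s = hpair (hsubst a r s) (hsubst b r s).
Proof. simpl; destruct H_eq_dec; easy. Qed.

Lemma hsubst_not_subtree t r s : ~ subtree r t -> hsubst t r s = t.
Proof.
  induction t as [|a IHa b IHb]; simpl; intros N.
  - destruct H_eq_dec as [<-|]; tauto.
  - destruct H_eq_dec as [<-|]; [tauto | rewrite IHa, IHb; tauto].
Qed.

Lemma hpair_diag_neq r : hpair r r <> r.
Proof. induction r; congruence. Qed.

(** Each replaced occurrence really changes, because [hpair r r] is never [r]. The converse is
    obtained by deciding [subtree]. *)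
Lemma subtree_hsubst r t : subtree r t <-> hsubst t r (hpair r r) <> t.
Proof.
  split.
  - induction t as [|a IHa b IHb].
    + intros [->|[]]; rewrite hsubst_same; easy.
    + intros Hs E; destruct (H_eq_dec (hpair a b) r) as [<-|N].
      * rewrite hsubst_same in E; eapply hpair_diag_neq, E.
      * rewrite hsubst_pair in E by assumption; injection E as Ea Eb.
        destruct Hs as [->|[|]]; intuition.
  - intros E.
    assert (D : subtree r t \/ ~ subtree r t).
    { clear E; induction t as [|a IHa b IHb]; simpl.
      - destruct (H_eq_dec r hbot); tauto.
      - destruct (H_eq_dec r (hpair a b)); tauto. }
    destruct D; [assumption|].
    destruct E; apply hsubst_not_subtree; assumption.
Qed.

(* The counters are kept apart by the left child of [endmark]: in [num], [chain]
   and [regs] no other node has left child <bot,bot>. *)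
Definition treeA : H := hpair hbot hbot.

Fixpoint num (n : nat) : H :=
  match n with 0 => hbot | S n => hpair hbot (num n) end.

Definition endmark (i : nat) : H := hpair treeA (num i).

Fixpoint chain (n : nat) (t : H) : H :=
  match n with 0 => t | S n => hpair hbot (chain n t) end.

Fixpoint regs (n j : nat) (e : nat -> nat) : H :=
  match n with
  | 0 => hbot
  | S n => hpair (chain (e j) (endmark j)) (regs n (S j) e)
  end.

(** In a register tree [endmark i] occurs at most once, so only the chain of register [i] gains or
    loses a cell. The pattern of [tdec] is the last cell of that chain, absent if the counter is
    0. *)
Definition tinc (i : nat) (x : H) : H := hsubst x (endmark i) (hpair hbot (endmark i)).
Definition tdec (i : nat) (x : H) : H := hsubst x (hpair hbot (endmark i)) (endmark i).

Lemma num_inj i j : num i = num j -> i = j.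
Proof.
  revert j; induction i; intros [|j]; simpl; intros E; try discriminate; auto.
  injection E; auto.
Qed.

Lemma chain_endmark_inj m n i : chain m (endmark i) = chain n (endmark i) -> m = n.
Proof.
  revert n; induction m; intros [|n]; simpl; intros E; try discriminate; auto.
  injection E; auto.
Qed.

Lemma endmark_not_subtree_num i j : ~ subtree (endmark i) (num j).
Proof. induction j; simpl; intuition discriminate. Qed.

Lemma endmark_subtree i j : subtree (endmark i) (endmark j) -> i = j.
Proof.
  intros [E|[Hs|Hs]].
  - injection E; apply num_inj.
  - simpl in Hs; intuition discriminate.
  - apply endmark_not_subtree_num in Hs as [].
Qed.

Lemma tinc_chain i j n :
  tinc i (chain n (endmark j)) = chain (if Nat.eq_dec j i then S n else n) (endmark j).
Proof.
  unfold tinc; induction n as [|n IH]; simpl chain.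
  - destruct Nat.eq_dec as [->|N]; [apply hsubst_same|].
    apply hsubst_not_subtree; intros Hs; apply endmark_subtree in Hs; auto.
  - rewrite hsubst_pair, IH, hsubst_not_subtree by (simpl; intuition discriminate).
    destruct Nat.eq_dec; reflexivity.
Qed.

Lemma tdec_chain i j n :
  tdec i (chain n (endmark j)) = chain (if Nat.eq_dec j i then pred n else n) (endmark j).
Proof.
  unfold tdec; induction n as [|n IH]; simpl chain.
  - replace (if Nat.eq_dec j i then _ else _) with 0 by (destruct Nat.eq_dec; auto).
    apply hsubst_not_subtree.
    assert (N : forall k, ~ subtree (hpair hbot (endmark i)) (num k)).
    { intros k Hs; apply (endmark_not_subtree_num i k).
      eapply subtree_trans; [|exact Hs]; simpl; auto. }
    intros [E|[Hs|Hs]]; [discriminate | | eapply N, Hs].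
    (* [treeA] is convertible to [num 1]. *)
    apply (N 1), Hs.
  - destruct (H_eq_dec (chain n (endmark j)) (endmark i)) as [E|E].
    + rewrite E, hsubst_same.
      destruct n; [injection E as E; apply num_inj in E as ->|discriminate].
      destruct Nat.eq_dec; easy.
    + rewrite hsubst_pair, IH, hsubst_not_subtree
        by (simpl; intuition congruence).
      destruct Nat.eq_dec as [->|]; destruct n; easy.
Qed.

Lemma tinc_regs i n j e : tinc i (regs n j e) = regs n j (upd e i (S (e i))).
Proof.
  revert j; induction n as [|n IH]; intros j; [reflexivity|].
  simpl regs; unfold tinc; rewrite hsubst_pair; [fold (tinc i (regs n (S j) e));
    fold (tinc i (chain (e j) (endmark j))); rewrite IH, tinc_chain|].
  - unfold upd at 2; destruct Nat.eq_dec as [->|]; reflexivity.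
  (* The whole tree is not an endmark: its left child is a counter, and no counter equals
     [treeA]. *)
  - intros E; injection E as E _; destruct (e j) as [|[|]]; discriminate.
Qed.

Lemma tdec_regs i n j e : tdec i (regs n j e) = regs n j (upd e i (pred (e i))).
Proof.
  revert j; induction n as [|n IH]; intros j; [reflexivity|].
  simpl regs; unfold tdec; rewrite hsubst_pair; [fold (tdec i (regs n (S j) e));
    fold (tdec i (chain (e j) (endmark j))); rewrite IH, tdec_chain|].
  - unfold upd at 2; destruct Nat.eq_dec as [->|]; reflexivity.
  - intros E; injection E as E _; destruct (e j) as [|[|]]; discriminate.
Qed.

Lemma regs_ext n j e e' : (forall i, j <= i -> e i = e' i) -> regs n j e = regs n j e'.
Proof.
  revert j; induction n; intros j Hj; simpl; f_equal; auto.
  - rewrite Hj; auto.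
  - apply IHn; intros; apply Hj; lia.
Qed.

Lemma regs_inj n j e e' i : j <= i < j + n -> regs n j e = regs n j e' -> e i = e' i.
Proof.
  revert j; induction n as [|n IH]; intros j Hi E; [lia|].
  injection E as E1 E2; destruct (Nat.eq_dec i j) as [->|].
  - apply chain_endmark_inj in E1; assumption.
  - apply (IH (S j)); auto; lia.
Qed.

(** The zero test: 0 is the only fixed point of [pred], and the tree determines every register below
    [n]. *)
Lemma tdec_regs_fixed i n e : i < n -> tdec i (regs n 0 e) = regs n 0 e <-> e i = 0.
Proof.
  intros Li; rewrite tdec_regs; split; intros E.
  - apply regs_inj with (i := i) in E; [|lia].
    rewrite upd_eq in E; lia.
  - apply regs_ext; intros k _; unfold upd.
    destruct Nat.eq_dec as [->|]; lia.
Qed.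

(* The label of a configuration is <sep, enc p>; [sep] occurs in no code and in
   no register tree. *)
Definition sep : H := hpair (hpair treeA hbot) (hpair treeA hbot).

Fixpoint enc (p : prog) : H :=
  match p with
  | Halt => treeA
  | Inc i p => hpair (hpair hbot (num i)) (enc p)
  | Dec i p => hpair hbot (hpair (num i) (enc p))
  | Loop i b p => hpair (hpair treeA (hpair hbot (num i))) (hpair (enc b) (enc p))
  end.

(** The first half separates program labels from the input label; the second keeps the pair of codes
    in a [Loop] from being [sep], whose two halves are [hpair treeA hbot]. *)
Lemma enc_neq p : enc p <> hbot /\ enc p <> hpair treeA hbot.
Proof.
  split; destruct p as [| | |i b p]; try discriminate.
  simpl; intros E; injection E as _ E.
  destruct p; discriminate.
Qed.

Lemma enc_inj p q : enc p = enc q -> p = q.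
Proof.
  revert q; induction p; intros []; simpl; intros E; try discriminate; auto;
    injection E; intros; f_equal; auto using num_inj.
Qed.

Lemma sep_num n : ~ subtree sep (num n).
Proof. induction n; simpl; intuition discriminate. Qed.

Lemma sep_chain n i : ~ subtree sep (chain n (endmark i)).
Proof.
  pose proof (sep_num i).
  induction n; simpl; intuition discriminate.
Qed.

Lemma sep_regs n j e : ~ subtree sep (regs n j e).
Proof.
  revert j; induction n as [|n IH]; intros j; [simpl; intuition discriminate|].
  intros [E|[Hs|Hs]].
  - injection E as _ E; destruct n; [discriminate|].
    injection E as E _; destruct (e (S j)) as [|[|]]; discriminate.
  - eapply sep_chain, Hs.
  - eapply IH, Hs.
Qed.

Lemma sep_enc p : ~ subtree sep (enc p).
Proof.
  induction p as [|i p IH|i p IH|i b IHb p IHp]; simpl;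
    try pose proof (sep_num i); try (intuition discriminate).
  - intuition (try discriminate).
    destruct i; discriminate.
  - destruct (enc_neq b); intuition (try discriminate).
    unfold sep, treeA in *; congruence.
Qed.

(** * Finite histories of labelled trees *)

Fixpoint history (l : list (H * H)) : H :=
  match l with
  | [] => hbot
  | (a, x) :: l => hpair (hpair (hpair sep a) x) (history l)
  end.

(** A labelled pair contains [sep], so it cannot lie inside the components of an entry and must be
    an entry itself. *)
Lemma subtree_history l a x :
  (forall b y, In (b, y) l -> ~ subtree sep b /\ ~ subtree sep y) ->
  subtree (hpair (hpair sep a) x) (history l) <-> In (a, x) l.
Proof.
  intros Hl.
  assert (T : forall t, subtree (hpair (hpair sep a) x) t -> subtree sep t).
  { intros t; apply subtree_trans; right; left; right; left; apply subtree_refl. }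
  induction l as [|[b y] l IH]; simpl; [intuition discriminate|].
  rewrite IH by (intros; apply Hl; right; assumption).
  destruct (Hl b y) as [Hb Hy]; [left; reflexivity|].
  split.
  - intros [E|[[E|[[E|[E|E]]|E]]|E]]; auto.
    + discriminate.
    + injection E as <- <-; auto.
    + discriminate.
    + intuition discriminate.
    + destruct Hb; auto.
    + destruct Hy; auto.
  - intros [E|]; [injection E as <- <-|]; auto.
Qed.

(** * The sentences *)

(** A finite list closed under [next], so that finitely many rules suffice. Inside a loop body the
    continuation is the loop itself. *)
Fixpoint points (p : prog) : list prog :=
  match p with
  | Halt => [Halt]
  | Inc i q | Dec i q => p :: points q
  | Loop i b q => p :: map (fun r => papp r p) (points b) ++ points q
  end.

Lemma points_refl p : In p (points p).
Proof. destruct p; simpl; auto. Qed.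

Lemma next_papp p q e :
  p <> Halt -> next (papp p q, e) = (papp (fst (next (p, e))) q, snd (next (p, e))).
Proof.
  destruct p as [|i p|i p|i b p]; try easy.
  intros _; change (papp (Loop i b p) q) with (Loop i b (papp p q)); cbn [next fst snd].
  destruct (e i); [reflexivity|].
  rewrite papp_assoc; reflexivity.
Qed.

Lemma points_next p k e : In k (points p) -> In (fst (next (k, e))) (points p).
Proof.
  revert k e; induction p as [|i p IH|i p IH|i b IHb p IHp]; intros k e Hk.
  - destruct Hk as [<-|[]]; simpl; auto.
  - destruct Hk as [<-|Hk]; right; [apply points_refl | apply IH, Hk].
  - destruct Hk as [<-|Hk]; right; [apply points_refl | apply IH, Hk].
  - assert (HL : forall e, In (fst (next (Loop i b p, e))) (points (Loop i b p))).
    { intros e0; simpl; right; apply in_or_app; destruct (e0 i).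
      - right; apply points_refl.
      - left; apply in_map_iff; exists b; auto using points_refl. }
    destruct Hk as [<-|Hk]; [apply HL|].
    apply in_app_or in Hk as [Hk|Hk].
    + apply in_map_iff in Hk as (c & <- & Hc).
      (* When the body is exhausted, the point is the loop itself; otherwise the step takes place
         within the body. *)
      assert (D : c = Halt \/ c <> Halt) by (destruct c; auto; right; discriminate).
      destruct D as [->|D]; [apply HL|].
      rewrite next_papp by assumption; right; apply in_or_app; left.
      apply in_map_iff; eexists; split; [reflexivity | apply IHb, Hc].
    + right; apply in_or_app; right; apply IHp, Hk.
Qed.

Fixpoint quote (t : H) : term :=
  match t with hbot => tbot | hpair a b => tpair (quote a) (quote b) end.

Lemma teval_quote e t : teval T_BT e (quote t) = t.
Proof. induction t; simpl; congruence. Qed.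

Lemma occurs_quote x t : ~ occurs x (quote t).
Proof. induction t; simpl; tauto. Qed.

(** Unlike [fSub], this admits any term on the left. Both membership and its negation are literals,
    so they may occur freely in Sigma-formulas. *)
Definition fNin (s t : term) : form := fEq (tsubst t s (tpair s s)) t.
Definition fIn (s t : term) : form := fNot (fNin s t).

Lemma sat_fIn e s t : sat T_BT e (fIn s t) <-> subtree (teval T_BT e s) (teval T_BT e t).
Proof. symmetry; apply subtree_hsubst. Qed.

Lemma sat_fNin e s t :
  sat T_BT e (fNin s t) <-> ~ subtree (teval T_BT e s) (teval T_BT e t).
Proof.
  rewrite subtree_hsubst; simpl; destruct (H_eq_dec
    (hsubst (teval T_BT e t) (teval T_BT e s) (hpair (teval T_BT e s) (teval T_BT e s)))
    (teval T_BT e t)); tauto.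
Qed.

(** Variable 0 is the tree [z] holding the run; variable 1 will be the universally quantified
    [x]. *)
Definition fstate (a : H) (x : term) : form :=
  fIn (tpair (quote (hpair sep a)) x) (tvar 0).
Definition fnstate (a : H) (x : term) : form :=
  fNin (tpair (quote (hpair sep a)) x) (tvar 0).

Definition tincT (i : nat) (x : term) : term :=
  tsubst x (quote (endmark i)) (quote (hpair hbot (endmark i))).
Definition tdecT (i : nat) (x : term) : term :=
  tsubst x (quote (hpair hbot (endmark i))) (quote (endmark i)).

(* Register 1 holds the output. *)
Definition rule (k : prog) : form :=
  fOr (fnstate (enc k) (tvar 1))
    match k with
    | Halt => fEq (tdecT 1 (tvar 1)) (tvar 1)
    | Inc i p => fstate (enc p) (tincT i (tvar 1))
    | Dec i p => fstate (enc p) (tdecT i (tvar 1))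
    | Loop i b p =>
        fOr (fAnd (fEq (tdecT i (tvar 1)) (tvar 1)) (fstate (enc p) (tvar 1)))
            (fAnd (fNot (fEq (tdecT i (tvar 1)) (tvar 1)))
                  (fstate (enc (papp b k)) (tvar 1)))
    end.

(* The input arrives under the label <sep, bot>, which does not depend on the
   program. *)
Definition start_rule (p : prog) (tail : H) : form :=
  fOr (fnstate hbot (tvar 1)) (fstate (enc p) (tpair (tvar 1) (quote tail))).

Definition rules (p : prog) (tail : H) : form :=
  fold_right (fun k phi => fAnd (rule k) phi) (start_rule p tail) (points p).

Definition matrix (p : prog) (tail : H) : form := fAllB 1 (tvar 0) (rules p tail).

(** Input and matrix enter separately, so the code of the sentence is easily computed from [m] and
    the code of [phi]. *)
Definition halting (m : nat) (phi : form) : form :=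
  fEx 0 (fAnd (fstate hbot (quote (chain m (endmark 0)))) phi).

Lemma Sigma_halting m p tail : Sigma 1 0 1 (halting m (matrix p tail)).
Proof.
  apply Sigma_ex, (Sigma_and 0 0 0 0 0 1); [apply Sigma_neq|].
  apply Sigma_allB; [simpl; lia|].
  unfold rules; induction (points p) as [|k l IH]; simpl;
    apply (Sigma_and 0 0 0 0 0 0) || apply (Sigma_or 0 0 0 0 0 0); try constructor; auto.
  apply (Sigma_or 0 0 0 0 0 0); [constructor|].
  destruct k; try constructor.
  apply (Sigma_or 0 0 0 0 0 0); apply (Sigma_and 0 0 0 0 0 0); constructor.
Qed.

Ltac occurs_closed :=
  simpl in *;
  repeat match goal with
  | Hx : _ \/ _ |- _ => destruct Hx
  | Hx : False |- _ => destruct Hx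
  | Hx : occurs _ (quote _) |- _ => destruct (occurs_quote _ _ Hx)
  end; auto.

Lemma sentence_halting m p tail : sentence (halting m (matrix p tail)).
Proof.
  assert (R : forall x, free x (rules p tail) -> x = 0 \/ x = 1).
  { intros x; unfold rules; induction (points p) as [|k l IH]; intros Hx.
    - occurs_closed.
    - destruct Hx as [Hx|Hx]; [|auto].
      destruct k; occurs_closed. }
  intros x [N [Hx|[N1 [Hx|Hx]]]]; [occurs_closed | occurs_closed |].
  destruct (R x Hx); auto.
Qed.

(** * Meaning of the sentences in the term model *)

Definition obeys (z x : H) (k : prog) : Prop :=
  subtree (hpair (hpair sep (enc k)) x) z ->
  match k with
  | Halt => tdec 1 x = x
  | Inc i p => subtree (hpair (hpair sep (enc p)) (tinc i x)) z
  | Dec i p => subtree (hpair (hpair sep (enc p)) (tdec i x)) z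
  | Loop i b p =>
      (tdec i x = x /\ subtree (hpair (hpair sep (enc p)) x) z) \/
      (tdec i x <> x /\ subtree (hpair (hpair sep (enc (papp b k))) x) z)
  end.

Lemma subtree_dec r t : subtree r t \/ ~ subtree r t.
Proof.
  rewrite subtree_hsubst; destruct (H_eq_dec (hsubst t r (hpair r r)) t); tauto.
Qed.

(** Sigma-formulas have no general implication, so rules are disjunctions; decidability of [subtree]
    gives them the force of implications. *)
Lemma sat_fOr_fNin e s t phi :
  sat T_BT e (fOr (fNin s t) phi) <->
  (subtree (teval T_BT e s) (teval T_BT e t) -> sat T_BT e phi).
Proof.
  change (sat T_BT e (fNin s t) \/ sat T_BT e phi <->
          (subtree (teval T_BT e s) (teval T_BT e t) -> sat T_BT e phi)).
  rewrite sat_fNin.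
  destruct (subtree_dec (teval T_BT e s) (teval T_BT e t)); tauto.
Qed.

Lemma sat_fstate e a x :
  sat T_BT e (fstate a x) <-> subtree (hpair (hpair sep a) (teval T_BT e x)) (e 0).
Proof.
  unfold fstate; rewrite sat_fIn; cbn [teval]; rewrite teval_quote; reflexivity.
Qed.

Lemma sat_fOr_fnstate e a x phi :
  sat T_BT e (fOr (fnstate a x) phi) <->
  (subtree (hpair (hpair sep a) (teval T_BT e x)) (e 0) -> sat T_BT e phi).
Proof.
  unfold fnstate; rewrite sat_fOr_fNin; cbn [teval]; rewrite teval_quote; reflexivity.
Qed.

Lemma teval_tincT e i x : teval T_BT e (tincT i x) = tinc i (teval T_BT e x).
Proof. unfold tincT, tinc; cbn [teval]; rewrite !teval_quote; reflexivity. Qed.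

Lemma teval_tdecT e i x : teval T_BT e (tdecT i x) = tdec i (teval T_BT e x).
Proof. unfold tdecT, tdec; cbn [teval]; rewrite !teval_quote; reflexivity. Qed.

Lemma sat_rule e k : sat T_BT e (rule k) <-> obeys (e 0) (e 1) k.
Proof.
  unfold rule, obeys; rewrite sat_fOr_fnstate.
  destruct k; cbn [sat]; rewrite ?sat_fstate, ?teval_tincT, ?teval_tdecT; reflexivity.
Qed.

Lemma sat_rules e p tail :
  sat T_BT e (rules p tail) <->
  (forall k, In k (points p) -> obeys (e 0) (e 1) k) /\
  (subtree (hpair (hpair sep hbot) (e 1)) (e 0) ->
   subtree (hpair (hpair sep (enc p)) (hpair (e 1) tail)) (e 0)).
Proof.
  unfold rules; induction (points p) as [|k l IH]; cbn [fold_right].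
  - unfold start_rule; rewrite sat_fOr_fnstate, sat_fstate; cbn [teval].
    rewrite teval_quote; simpl; intuition.
  - cbn [sat]; rewrite IH, sat_rule; simpl; intuition (subst; auto).
Qed.

Lemma sat_halting e m p tail :
  sat T_BT e (halting m (matrix p tail)) <->
  exists z,
    subtree (hpair (hpair sep hbot) (chain m (endmark 0))) z /\
    forall x, subtree x z ->
      (forall k, In k (points p) -> obeys z x k) /\
      (subtree (hpair (hpair sep hbot) x) z ->
       subtree (hpair (hpair sep (enc p)) (hpair x tail)) z).
Proof.
  unfold halting, matrix, fAllB; cbn [sat].
  split; intros [z [Hi Hz]]; exists z; split.
  - rewrite sat_fstate, teval_quote in Hi; exact Hi.
  - intros x Hx; specialize (Hz x); rewrite sat_rules in Hz; apply Hz.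
    apply sat_fIn, Hx.
  - rewrite sat_fstate, teval_quote; exact Hi.
  - intros x Hx; rewrite sat_rules; apply Hz.
    apply sat_fIn in Hx; exact Hx.
Qed.

(** * Truth of the sentences and halting runs *)

Definition head_reg (k : prog) : nat :=
  match k with Halt => 0 | Inc i _ | Dec i _ | Loop i _ _ => i end.

Definition max_reg (p : prog) : nat := list_max (map head_reg (points p)).

Lemma head_reg_le p k : In k (points p) -> head_reg k <= max_reg p.
Proof.
  intros Hk; assert (F := proj1 (list_max_le (map head_reg (points p)) _) (le_n _)).
  eapply Forall_forall in F; [exact F | apply in_map, Hk].
Qed.

Definition state (n : nat) (z : H) (c : config) : Prop :=
  subtree (hpair (hpair sep (enc (fst c))) (regs n 0 (snd c))) z.

(** The substitutions and the zero test act on register trees as [next] acts on registers. At [Halt]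
    the configuration is fixed and only the output test remains. *)
Lemma obeys_state n z k e : head_reg k < n -> 1 < n -> state n z (k, e) ->
  obeys z (regs n 0 e) k <-> state n z (next (k, e)) /\ (k = Halt -> e 1 = 0).
Proof.
  unfold obeys, state; cbn [fst snd]; intros Lk L1 Hs.
  destruct k as [|i p|i p|i b p]; cbn [next fst snd head_reg] in *.
  - rewrite tdec_regs_fixed by assumption; tauto.
  - rewrite tinc_regs; split; [intros Ho; split; [auto | discriminate] | tauto].
  - rewrite tdec_regs; split; [intros Ho; split; [auto | discriminate] | tauto].
  - rewrite tdec_regs_fixed by assumption.
    destruct (e i); split; try tauto.
    + intros Ho; split; [|discriminate]; intuition.
    + intros Ho; split; [|discriminate]; intuition discriminate.
    + intros [Ho _] _; right; split; [discriminate | exact Ho].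
Qed.

Lemma reach_fixed c c' : reach c c' -> next c = c -> c = c'.
Proof. induction 1; intros E; auto. rewrite E in *; auto. Qed.

(** A halting run has a finite orbit closed under [next]; this is what a single tree can store. *)
Lemma reach_orbit c c' : reach c c' -> next c' = c' ->
  exists l, In c l /\ forall d, In d l -> In (next d) l /\ reach d c'.
Proof.
  intros Hr Hf; induction Hr as [c|c c' Hr IH].
  - exists [c]; split; [left; auto|].
    intros d [<-|[]]; rewrite Hf; split; [left; auto | apply reach_refl].
  - destruct (IH Hf) as (l & Hc & Hl); exists (c :: l); split; [left; auto|].
    intros d [<-|Hd].
    + split; [right; auto | apply reach_next; auto].
    + destruct (Hl d Hd); split; [right|]; auto.
Qed.

Definition init (m : nat) : nat -> nat := upd (fun _ => 0) 0 m.

(** Only register 0 depends on the input; the others start at 0, so their tree can be a constant of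
    the matrix. *)
Definition init_tail (p : prog) : H := regs (S (max_reg p)) 1 (fun _ => 0).

Lemma regs_init p m :
  regs (2 + max_reg p) 0 (init m) = hpair (chain m (endmark 0)) (init_tail p).
Proof.
  unfold init_tail; cbn [regs Nat.add]; f_equal.
  f_equal; apply regs_ext; intros i Hi; apply upd_neq; lia.
Qed.

Lemma halting_true p m e' : reach (p, init m) (Halt, e') ->
  true_in T_BT (halting m (matrix p (init_tail p))) <-> e' 1 = 0.
Proof.
  intros Hr; unfold true_in; set (n := 2 + max_reg p).
  assert (L : forall k, In k (points p) -> head_reg k < n)
    by (intros k Hk; apply head_reg_le in Hk; unfold n; lia).
  assert (L1 : 1 < n) by (unfold n; lia).
  split.
  - intros Ht; specialize (Ht (fun _ => hbot)); apply sat_halting in Ht.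
    destruct Ht as (z & Hi & Hz).
    (* Whatever else [z] contains, the rules force it to contain the whole run. The bounded
       quantifier covers every register tree met, each being a subtree of [z]. *)
    assert (Inv : forall c c', reach c c' -> In (fst c) (points p) -> state n z c ->
      fst c' = Halt -> snd c' 1 = 0).
    { assert (St : forall k e, In k (points p) -> state n z (k, e) ->
        state n z (next (k, e)) /\ (k = Halt -> e 1 = 0)).
      { intros k e Hk Hs; apply obeys_state; auto.
        apply Hz; auto.
        eapply subtree_right, Hs. }
      intros c c' Hr'; induction Hr' as [[k e]|[k e] c' Hr' IH]; intros Hk Hs.
      - apply St; assumption.
      - apply IH; [apply points_next, Hk | apply St; assumption]. }
    apply (Inv _ _ Hr); [apply points_refl | | reflexivity].
    unfold state, n; cbn [fst snd]; rewrite regs_init; apply Hz; auto.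
    eapply subtree_right, Hi.
  - intros E e; apply sat_halting.
    destruct (reach_orbit _ _ Hr eq_refl) as (l & Hc & Hl).
    pose (tr := fun c : config => (enc (fst c), regs n 0 (snd c))).
    (* The witness [z] stores the input entry followed by the orbit of the initial configuration. *)
    pose (l' := (hbot, chain m (endmark 0)) :: map tr l).
    assert (S : forall a x, subtree (hpair (hpair sep a) x) (history l') <-> In (a, x) l').
    { intros a x; apply subtree_history; intros b y [Hb|Hb].
      - injection Hb as <- <-; split; [simpl; intuition discriminate | apply sep_chain].
      - apply in_map_iff in Hb as (c & Hb & _); apply pair_equal_spec in Hb as [<- <-].
        auto using sep_enc, sep_regs. }
    assert (I : forall c, In c l -> state n (history l') c)
      by (intros c Hcl; apply S; right; apply (in_map tr), Hcl).
    exists (history l'); split; [apply S; left; reflexivity|].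
    intros x _; split.
    + intros k Hk Hs.
      assert (Ho : obeys (history l') x k); [|apply Ho, Hs].
      apply S in Hs; destruct Hs as [Hs|Hs].
      * injection Hs as Hs _; destruct (enc_neq k); congruence.
      * apply in_map_iff in Hs as ([k1 e1] & Hs & Hin).
        apply pair_equal_spec in Hs as [Hs <-]; apply enc_inj in Hs as <-.
        cbn [fst snd] in *.
        apply obeys_state; auto.
        destruct (Hl _ Hin) as [Hn Hd]; split; auto.
        (* A halted configuration in the orbit still reaches the final one, hence equals it and has
           output 0. *)
        intros ->; apply reach_fixed in Hd; [congruence | reflexivity].
    + intros Hs; apply S in Hs; destruct Hs as [Hs|Hs].
      * injection Hs as <-; rewrite <- regs_init; apply (I _ Hc).
      * apply in_map_iff in Hs as (c & Hs & _); injection Hs as Hs _.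
        destruct (enc_neq (fst c)); congruence.
Qed.

(** * Coding the sentences recursively *)

Fixpoint rConst (c : nat) : recalg :=
  match c with 0 => rZero | S c => rComp rSucc [rConst c] end.

Definition rAdd : recalg := rPrim (rProj 0) (rComp rSucc [rProj 1]).

Definition rTri : recalg := rPrim rZero (rComp rAdd [rComp rSucc [rProj 0]; rProj 1]).

Definition rNpair (f g : recalg) : recalg :=
  rComp rAdd [g; rComp rTri [rComp rAdd [g; f]]].

Lemma computes_rConst c v : computes (rConst c) v c.
Proof. induction c; repeat econstructor; eassumption. Qed.

Lemma computes_rAdd a b : computes rAdd [a; b] (a + b).
Proof. induction a; repeat econstructor; eassumption. Qed.

(** Triangular numbers, spelled so that [npair a b] is [b + tri (b + a)] by conversion. *)
Definition tri (n : nat) : nat := nat_rec (fun _ => nat) 0 (fun i m => S i + m) n.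

Lemma computes_rTri n : computes rTri [n] (tri n).
Proof.
  induction n as [|n IH]; [repeat econstructor|].
  eapply c_primS; [exact IH|].
  eapply c_comp; [repeat econstructor | apply (computes_rAdd (S n))].
Qed.

Lemma computes_rNpair f g v a b :
  computes f v a -> computes g v b -> computes (rNpair f g) v (npair a b).
Proof.
  intros Hf Hg; change (npair a b) with (b + tri (b + a)).
  repeat (eassumption || apply computes_rAdd || apply computes_rTri || econstructor).
Qed.

(* Dispatching on the algorithm keeps unification from evaluating the codes. *)
Ltac npairs :=
  repeat match goal with
  | |- computes (rNpair _ _) _ _ => apply computes_rNpair
  | |- computes (rConst _) _ _ => apply computes_rConst
  | |- computes (rProj _) _ _ => apply c_proj; reflexivity
  end.

Definition rChain : recalg :=
  rPrim (rConst (tcode (quote (endmark 0))))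
        (rNpair (rConst 2) (rNpair (rConst (tcode tbot)) (rProj 1))).

Lemma computes_rChain m : computes rChain [m] (tcode (quote (chain m (endmark 0)))).
Proof.
  induction m as [|m IH]; [apply c_prim0, computes_rConst|].
  eapply c_primS; [exact IH|].
  cbn [chain quote tcode]; npairs.
Qed.

(** The diagonal function: its argument is used both as the input, through [rChain], and as the code
    of the matrix, through [rProj 0]. The constants are the tags of [tcode] and [fcode]. *)
Definition rHalting : recalg :=
  let z := rConst (tcode (tvar 0)) in
  let i := rNpair (rConst 2) (rNpair (rConst (tcode (quote (hpair sep hbot)))) rChain) in
  rNpair (rConst 5) (rNpair (rConst 0) (rNpair (rConst 2) (rNpair
    (rNpair (rConst 1) (rNpair (rConst 0) (rNpair
       (rNpair (rConst 3) (rNpair z (rNpair i (rNpair (rConst 2) (rNpair i i))))) z)))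
    (rProj 0)))).

Lemma computes_rHalting phi :
  computes rHalting [fcode phi] (fcode (halting (fcode phi) phi)).
Proof.
  unfold rHalting, halting, fstate, fIn, fNin; cbn [fcode tcode quote]; npairs;
    apply computes_rChain.
Qed.

(** * Diagonalization *)

Lemma halting_compile g m y (p := compile g [0] 1 2) : computes g [m] y ->
  true_in T_BT (halting m (matrix p (init_tail p))) <-> y = 0.
Proof.
  intros Cy; destruct (compile_correct g [m] y Cy) with
    (ins := [0]) (out := 1) (n := 2) (e := init m) as (e' & R & Ey & _); auto.
  specialize (R Halt); rewrite papp_Halt in R.
  rewrite <- Ey; apply halting_true, R.
Qed.

Theorem theorem2 : undecidable (Sigma_true T_BT 1 0 1).
Proof.
  intros [f Hf].
  pose (p := compile (rComp f [rHalting]) [0] 1 2).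
  set (phi := matrix p (init_tail p)).
  assert (T : forall y, computes f [fcode (halting (fcode phi) phi)] y ->
    (true_in T_BT (halting (fcode phi) phi) <-> y = 0)).
  { intros y Cy; apply halting_compile.
    eapply c_comp; [constructor; [apply computes_rHalting | constructor] | exact Cy]. }
  destruct (Hf (fcode (halting (fcode phi) phi))) as [[(q & Eq & _ & _ & Ht) C]|[N C]];
    apply T in C.
  (* If [f] answers 1, the sentence is true, although its truth amounts to [1 = 0]. *)
  - apply fcode_inj in Eq; rewrite <- Eq in Ht.
    apply C in Ht; discriminate.
  (* If [f] answers 0, the sentence is true and thus belongs to the set that [f] excludes it
     from. *)
  - apply N; eexists; split; [reflexivity|]; split; [apply Sigma_halting|].
    split; [apply sentence_halting | apply C; reflexivity].
Qed.
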